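(* Let $n\ge 1$ and $k\ge n$ be integers, and let $K$ be the transition matrix of the Burnside process on $[k]^n$ (defined in the context), with stationary distribution $$\pi(u)=\frac{1}{B_n\,|O_u|},\qquad u\in[k]^n.$$ Then for every starting state $u\in[k]^n$ and every integer $t\ge 0$, $$\|K_u^t-\pi\|_{TV}\le n\left(1-\frac{1}{2k}\right)^t .$$ Consequently, for every $\epsilon>0$ the mixing time of $K$ satisfies $$t_{\mathrm{mix}}(\epsilon)\le 2k\log\left(\frac{n}{\epsilon}\right).$$
   Context: $[k]=\{1,\dots,k\}$. The symmetric group $S_k$ acts on $[k]^n$ by $\sigma(u_1,\dots,u_n)=(\sigma(u_1),\dots,\sigma(u_n))$. For $u\in[k]^n$, $O_u=\{\sigma u:\sigma\in S_k\}$ is its orbit and $G_u=\{\sigma\in S_k:\sigma u=u\}$ its stabilizer; for $\sigma\in S_k$, $X_\sigma=\{v\in[k]^n:\sigma v=v\}$. The Burnside process on $[k]^n$ is the Markov chain which, from state $u$, (1) lets $J\subseteq[k]$ be the set of values appearing among the coordinates of $u$ and chooses $\sigma$ uniformly at random among permutations of $[k]$ fixing every element of $J$ (i.e. uniformly from $G_u$); (2) then produces $v\in[k]^n$ by choosing each coordinate independently and uniformly from the set of fixed points of $\sigma$. Equivalently $K(u,v)=\sum_{\sigma\in G_u\cap G_v}\frac{1}{|G_u|\,|X_\sigma|}$. $B_n$ is the $n$th Bell number (number of set partitions of $[n]$); the orbits of this action correspond to set partitions of $[n]$. $K_u^t=K^t(u,\cdot)$, $\|\mu-\nu\|_{TV}=\frac12\sum_y|\mu(y)-\nu(y)|$,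 and $t_{\mathrm{mix}}(\epsilon)=\min\{t:\max_{u}\|K_u^t-\pi\|_{TV}\le\epsilon\}$.
   Formalization: The mixing-time bound is stated for 0 < ε < 1 only: for ε > n it is false (t_mix = 0 while 2k log(n/ε) < 0), and for 1 ≤ ε ≤ n it is trivial, since total variation never exceeds 1 and t = 0 works. *)

(* Defs.v *)
From HB Require Import structures.
From mathcomp Require Import all_boot all_order all_algebra all_fingroup.
From mathcomp Require Import all_classical all_reals all_analysis.
Set Implicit Arguments. Unset Strict Implicit. Unset Printing Implicit Defensive.
Import Order.TTheory GRing.Theory Num.Theory.
Local Open Scope ring_scope.

Section Burnside.
Variables (R : realType) (n k : nat).

Definition state := {ffun 'I_n -> 'I_k}.

Definition act (s : {perm 'I_k}) (u : state) : state := [ffun i => s (u i)].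

Definition orbitB (u : state) : {set state} := [set act s u | s : {perm 'I_k}].
Definition stab (u : state) : {set {perm 'I_k}} := [set s | act s u == u].
Definition fixset (s : {perm 'I_k}) : {set state} := [set v | act s v == v].

Definition Kb (u v : state) : R :=
  \sum_(s in stab u :&: stab v) (#|stab u|%:R * #|fixset s|%:R)^-1.

Fixpoint Kpow (t : nat) (u v : state) : R :=
  match t with
  | 0 => (u == v)%:R
  | t'.+1 => \sum_(w : state) Kpow t' u w * Kb w v
  end.

Definition tv (mu nu : state -> R) : R := 2^-1 * \sum_(y : state) `|mu y - nu y|.

End Burnside.

Definition Bell (m : nat) : nat :=
  #|[set P : {set {set 'I_m}} | finset.partition P [set: 'I_m]]|.

Definition piB (R : realType) (n k : nat) (u : state n k) : R :=
  ((Bell n)%:R * #|orbitB u|%:R)^-1.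

(* Main.v *)
Require Import Defs.
From HB Require Import structures.
From mathcomp Require Import all_boot all_order all_algebra all_fingroup.
From mathcomp Require Import ring lra reals.
Import Order.TTheory GRing.Theory Num.Theory.
Local Open Scope ring_scope.

(** Given the permutation [s] drawn in the first half of a step, the new state
is a sequence of [n] independent uniform points of the fixed set [Fx s]. Follow
the random set [F = Fx s], with the distance
[d(F, G) = #|G :\: F| / #|G|] for [#|F| <= #|G|], the total variation distance
between the uniform laws on [F] and on [G]. A function of states bounded by 1
becomes [2n]-Lipschitz in [F], and every further step contracts [d] by
[1 - 1/(2k)]:
- from [F] and [G], throw [n] balls into each in such a way that the occupied
  sets [J'] of [F] and [J''] of [G] satisfy [J'' :&: F \subset J'] and
  [#|J'| <= #|J''|]; then [#|J'' :\: J'| <= #|J'' :\: F|], and by symmetry each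
  point of [J''] is as likely as any other to lie outside [F];
- from [J'] and [J''], couple the uniform permutations fixing them pointwise so
  that the expected distance of their fixed sets is at most [#|J'' :\: J'|]
  times the mean of [1 / #|Fx s|], where [s] fixes [J''].
Since [s] has one fixed point outside [J''] on average (if [J''] is not
everything), this gives the factor [1 - 1/k] unless all [k] values occur, which
has probability at most 1/2. Both couplings are used in dual form, as
inequalities between averages. *)

(** * Averages over finite sets *)

Section Average.
Context {R : realFieldType} {T : finType}.
Implicit Types (A : {set T}) (H : T -> R).

Definition avg A H : R := (\sum_(x in A) H x) / #|A|%:R.

Lemma avg_le A H1 H2 :
  {in A, forall x, H1 x <= H2 x} -> avg A H1 <= avg A H2.
Proof.
by move=> le12; apply: ler_wpM2r; rewrite ?invr_ge0 ?ler0n //; apply: ler_sum.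
Qed.

Lemma eq_avg A H1 H2 : {in A, H1 =1 H2} -> avg A H1 = avg A H2.
Proof. by move=> e; congr (_ / _); apply: eq_bigr. Qed.

Lemma avgD A H1 H2 : avg A (fun x => H1 x + H2 x) = avg A H1 + avg A H2.
Proof. by rewrite /avg big_split mulrDl. Qed.

Lemma avgN A H : avg A (fun x => - H x) = - avg A H.
Proof. by rewrite /avg sumrN mulNr. Qed.

Lemma avgZ A c H : avg A (fun x => c * H x) = c * avg A H.
Proof. by rewrite /avg -mulr_sumr mulrA. Qed.

Lemma card_neq0 A : A != set0 -> #|A|%:R != 0 :> R.
Proof. by rewrite pnatr_eq0 cards_eq0. Qed.

Lemma sum_cst A (c : R) : \sum_(x in A) c = #|A|%:R * c.
Proof. by rewrite sumr_const mulr_natl. Qed.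

Lemma avg_cst A c : A != set0 -> avg A (fun=> c) = c.
Proof.
by move=> A0; rewrite /avg sum_cst mulrC mulKf ?card_neq0.
Qed.

Lemma avg_ge0 A H : {in A, forall x, 0 <= H x} -> 0 <= avg A H.
Proof. by move=> H0; rewrite mulr_ge0 ?invr_ge0 ?ler0n// sumr_ge0. Qed.

Lemma card_sum_mem A : #|A|%:R = \sum_x (x \in A)%:R :> R.
Proof.
rewrite -sum1_card natr_sum big_mkcond /=.
by apply: eq_bigr => x _; case: (x \in A).
Qed.

End Average.

(** * Pointwise stabilizers and the fixed sets of their elements *)

Section Perms.
Context {R : realFieldType} {k : nat}.
Implicit Types (s t : {perm 'I_k}) (J : {set 'I_k}).

Definition Fx s : {set 'I_k} := [set x | s x == x].
Definition pfix J : {set {perm 'I_k}} := [set s | J \subset Fx s].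

Lemma FxP s x : reflect (s x = x) (x \in Fx s).
Proof. by rewrite inE; apply: eqP. Qed.

Lemma pfixP J s : reflect {in J, forall x, s x = x} (s \in pfix J).
Proof.
rewrite inE; apply: (iffP subsetP) => H x xJ; first exact/FxP/H.
exact/FxP/H.
Qed.

Lemma pfix_neq0 J : pfix J != set0.
Proof. by apply/set0Pn; exists 1%g; apply/pfixP => x _; rewrite perm1. Qed.

Lemma card_Fx_ge J s : s \in pfix J -> (#|J| <= #|Fx s|)%N.
Proof. by rewrite inE => /subset_leq_card. Qed.

(** The product applies [tperm a c] first, so [a] is inserted into the cycle of [s] right after
    [c]. *)
Lemma Fx_tperm_mul a c s : a \in Fx s -> c != a ->
  Fx (tperm a c * s)%g = Fx s :\: [set a; c].
Proof.
move=> /FxP sa ca; apply/setP => x; rewrite !inE permM.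
case: tpermP => [->|->|/eqP xa /eqP xc].
- rewrite eqxx /=; apply/negbTE/eqP => sc; case/eqP: ca.
  by apply: (@perm_inj _ s); rewrite sc sa.
- by rewrite eqxx orbT sa /= eq_sym (negbTE ca).
- by rewrite (negbTE xa) (negbTE xc).
Qed.

(** A permutation fixing [J] pointwise is [tperm a c * s] for exactly one [s] that also fixes [a],
    where [c] is the preimage of [a], possibly [a] itself. *)
Lemma sum_pfix_split (H : {perm 'I_k} -> R) J a : a \notin J ->
  \sum_(s in pfix J) H s =
  \sum_(s in pfix (a |: J)) \sum_(c in ~: J) H (tperm a c * s)%g.
Proof.
move=> aJ.
rewrite (partition_big (fun s => (s^-1)%g a) (mem (~: J))) /=; last first.
  move=> s /pfixP sJ; rewrite inE; apply/negP => cJ; case/negP: aJ.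
  by have := sJ _ cJ; rewrite permKV => ->.
rewrite exchange_big /=; apply: eq_bigr => c; rewrite inE => cJ.
rewrite (reindex_inj (mulgI (tperm a c))) /=; apply: eq_bigl => s.
apply/andP/pfixP => [[/pfixP sJ /eqP sc] x|sJ].
  rewrite !inE => /orP[/eqP ->|xJ].
    move/(congr1 (tperm a c * s)%g): sc; rewrite permKV permM tpermR.
    exact: esym.
  have := sJ x xJ; rewrite permM tpermD //.
    by apply: contraNneq aJ => ->.
  by apply: contraNneq cJ => ->.
split.
  apply/pfixP => x xJ; rewrite permM tpermD ?sJ ?inE ?xJ ?orbT//.
    by apply: contraNneq aJ => ->.
  by apply: contraNneq cJ => ->.
apply/eqP/(@perm_inj _ (tperm a c * s)%g).
by rewrite permKV permM tpermR sJ ?setU11.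
Qed.

Lemma card_pfix_split J a : a \notin J ->
  #|pfix J| = (#|pfix (a |: J)| * #|~: J|)%N.
Proof.
move=> aJ; apply/eqP; rewrite -(eqr_nat R) natrM.
have := sum_pfix_split (fun=> 1) J a aJ.
by rewrite !sum_cst mulr1 => ->; rewrite mulr1 mulrC.
Qed.

Lemma avg_pfix_split (H : {perm 'I_k} -> R) J a : a \notin J ->
  avg (pfix J) H =
  avg (pfix (a |: J)) (fun s => avg (~: J) (fun c => H (tperm a c * s)%g)).
Proof.
move=> aJ; rewrite {1}/avg (sum_pfix_split _ _ _ aJ) (card_pfix_split _ _ aJ).
by rewrite /avg -mulr_suml natrM invfM; ring.
Qed.

(** Each point outside [J] is fixed with probability [1 / #|~: J|], by [card_pfix_split]. *)
Lemma avg_card_Fx J : J != setT ->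
  avg (pfix J) (fun s => #|Fx s|%:R) = #|J|.+1%:R :> R.
Proof.
move=> JT; rewrite /avg.
under eq_bigr do rewrite (card_sum_mem (Fx _)).
rewrite exchange_big /= (bigID (mem J)) /=.
have -> : \sum_(x in J) \sum_(s in pfix J) (x \in Fx s)%:R =
          #|J|%:R * #|pfix J|%:R :> R.
  rewrite -sum_cst; apply: eq_bigr => x xJ.
  rewrite -[RHS]mulr1 -sum_cst; apply: eq_bigr => s /pfixP sJ.
  by have /FxP -> := sJ x xJ.
have Jc0 : #|~: J|%:R != 0 :> R.
  by rewrite card_neq0 // -setCT (inj_eq (@setC_inj _)).
have -> : \sum_(x | x \notin J) \sum_(s in pfix J) (x \in Fx s)%:R =
          #|pfix J|%:R :> R.
  transitivity (\sum_(x in ~: J) (#|pfix J|%:R / #|~: J|%:R) : R); last first.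
    by rewrite sum_cst mulrC divfK.
  apply: eq_big => x; rewrite ?inE // => xJ.
  rewrite (card_pfix_split _ _ xJ) natrM mulfK // card_sum_mem.
  rewrite big_mkcond /=; apply: eq_bigr => s _.
  by rewrite !inE subUset sub1set inE; case: eqP => //=; case: (J \subset _).
by rewrite -[X in _ + X]mul1r -mulrDl natr1 mulfK ?card_neq0 ?pfix_neq0.
Qed.

End Perms.

(** * Comparison of two pointwise stabilizers *)

Section Transport.
Context {R : realFieldType} {k : nat}.
Implicit Types (s t : {perm 'I_k}) (J B : {set 'I_k}).

(** Inserting [a] into the cycle of [c] loses [a], unless [c = a], and also [c] if it was fixed. *)
Lemma cardsD_tperm B a c s : a \in B -> a \in Fx s ->
  #|B :\: Fx (tperm a c * s)%g| =
  (#|B :\: Fx s| + (c != a) + (c \in (B :&: Fx s) :\ a))%N.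
Proof.
move=> aB aF; have [->|ca] := eqVneq c a.
  by rewrite tperm1 mul1g setD11 !addn0.
have -> : B :\: Fx (tperm a c * s)%g = a |: (B :&: [set c] :|: B :\: Fx s).
  rewrite Fx_tperm_mul //; apply/setP => x; rewrite !inE.
  case: (eqVneq x a) => [->|xa] /=; first by rewrite aB.
  by case: (x == c); case: (x \in B); case: (s x == x).
move: (aF); rewrite inE => aF'.
rewrite cardsU1 !inE (eq_sym a c) (negbTE ca) aF' aB /= add1n addn1 addSn.
congr _.+1; have [cBF|cBF] := boolP (c \in B :\: Fx s).
  have /setUidPr -> : B :&: [set c] \subset B :\: Fx s.
    by apply/subsetP => x; rewrite !inE => /andP[_ /eqP ->]; move: cBF; rewrite !inE.
  by move: cBF; rewrite !inE => /andP[/negbTE -> ->]; rewrite addn0.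
have [cB|cB] := boolP (c \in B); last first.
  suff -> : B :&: [set c] = set0 by rewrite set0U addn0.
  by apply/setP => x; rewrite !inE; case: eqP => [->|]; rewrite ?(negbTE cB) ?andbF.
have -> : B :&: [set c] = [set c] by apply/setIidPr; rewrite sub1set.
rewrite cardsU1 cBF addnC; congr addn.
by move: cBF; rewrite !inE cB andbT negbK ?cB => ->.
Qed.

Lemma avg_loss B J a s : a \notin J -> a |: J \subset B -> s \in pfix (a |: J) ->
  avg (~: J) (fun c => #|B :\: Fx (tperm a c * s)%g|%:R) =
  #|B :\: Fx s|%:R * (1 - #|~: J|%:R^-1) + 1
   + (#|B|%:R - #|J|%:R - 2) / #|~: J|%:R :> R.
Proof.
move=> aJ aJB sJ; have aB : a \in B by apply: (subsetP aJB); rewrite setU11.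
have aF : a \in Fx s by apply/FxP/(pfixP _ _ sJ); rewrite setU11.
have aC : a \in ~: J by rewrite inE.
have JC0 : ~: J != set0 by apply/set0Pn; exists a.
have C0 := card_neq0 (R := R) _ JC0.
apply: (mulIf C0); rewrite /avg divfK //.
under eq_bigr do rewrite cardsD_tperm // !natrD.
rewrite !big_split /= sum_cst.
have -> : \sum_(c in ~: J) (c != a)%:R = #|~: J|%:R - 1 :> R.
  rewrite (cardsD1 a) aC natrD addrAC subrr add0r card_sum_mem big_mkcond /=.
  by apply: eq_bigr => c _; rewrite in_setD1 andbC; case: (c \in ~: J).
have -> : \sum_(c in ~: J) (c \in (B :&: Fx s) :\ a)%:R =
          #|B|%:R - #|B :\: Fx s|%:R - #|J|%:R - 1 :> R.
  have -> : #|B|%:R = #|B :\: Fx s|%:R + #|J|%:R + 1 + #|(B :&: Fx s) :\: (a |: J)|%:R :> R.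
    rewrite -(cardsID (Fx s) B) -(cardsID (a |: J) (B :&: Fx s)).
    have /setIidPr -> : a |: J \subset B :&: Fx s.
      by rewrite subsetI aJB; move: sJ; rewrite inE.
    by rewrite cardsU1 aJ !natrD mulr1n; ring.
  rewrite [X in _ = X](_ : _ = #|(B :&: Fx s) :\: (a |: J)|%:R); last by ring.
  rewrite card_sum_mem big_mkcond /=; apply: eq_bigr => c _.
  rewrite !inE negb_or; case: (c \in J) => //=; first by rewrite andbF.
  by rewrite andbT.
by field.
Qed.

(* Dual form of a coupling of uniform [s] in [pfix J''] and [t] in [pfix J'] for
   which the conditional mean of [#|Fx s :\: Fx t|] given [s] is
   [#|J'' :\: J'| + (#|Fx s| - #|J''| - 1) * kap], and [#|Fx t| <= #|Fx s|].
   Keeping [X] and [Y] arbitrary lets one-point removals be chained. *)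
Lemma transport_nested J' J'' : J' \subset J'' ->
  exists2 kap : R, 0 <= kap <= 1 &
  forall (H X Y : {perm 'I_k} -> R),
    (forall s, 0 <= Y s) ->
    (forall s t, s \in pfix J'' -> t \in pfix J' -> (#|Fx t| <= #|Fx s|)%N ->
       H t <= X s + Y s * #|Fx s :\: Fx t|%:R) ->
  avg (pfix J') H <=
  avg (pfix J'') (fun s => X s + Y s * (#|J'' :\: J'|%:R
                      + (#|Fx s|%:R - #|J''|%:R - 1) * kap)).
Proof.
move e : #|J'' :\: J'| => n; elim: n J' e => [|n IH] J' e sJ.
  have eJ : J' = J''.
    by apply/eqP; rewrite eqEsubset sJ -setD_eq0 -cards_eq0 e.
  subst J'; exists 0; first by rewrite lexx ler01.
  move=> H X Y Y0 HXY; apply: avg_le => s sJ''.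
  by have := HXY s s sJ'' sJ'' (leqnn _); rewrite setDv cards0 !(mulr0n, mulr0, addr0).
have /card_gt0P[a] : (0 < #|J'' :\: J'|)%N by rewrite e.
rewrite inE => /andP[aJ' aJ''].
have sJ1 : a |: J' \subset J'' by rewrite subUset sub1set aJ''.
have e1 : #|J'' :\: (a |: J')| = n.
  move: e; rewrite (cardsD1 a) inE aJ' aJ'' => -[<-].
  by congr #|pred_of_set _|; rewrite setDDl setUC.
have [kap1 /andP[kap0 kapl1] IH1] := IH _ e1 sJ1.
set m : R := #|~: J'|%:R.
have m1 : 1 <= m by rewrite ler1n; apply/card_gt0P; exists a; rewrite inE.
have m0 : 0 < m by apply: lt_le_trans m1.
have im0 : 0 <= m^-1 by rewrite invr_ge0 ltW.
have im1 : m^-1 <= 1 by rewrite invf_le1.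
(* By [avg_loss], a mean loss [x] becomes [x * (1 - 1/m) + 1 + (#|Fx s| - #|J'| - 2) / m]. Since
   [#|J'| = #|J''| - (n + 1)], the term [n] becomes [n + 1] and [kap1] becomes this coefficient. *)
exists ((1 - m^-1) * kap1 + m^-1).
  by apply/andP; split; nra.
move=> H X Y Y0 HXY; rewrite (avg_pfix_split _ _ _ aJ').
have JC0 : ~: J' != set0 by apply/set0Pn; exists a; rewrite inE.
have Y1 s : 0 <= Y s * (1 - m^-1) by rewrite mulr_ge0 // subr_ge0.
(* [X1] collects the part of [avg_loss] that is independent of the second permutation. *)
pose X1 s := X s + Y s * (1 + (#|Fx s|%:R - #|J'|%:R - 2) / m).
apply: le_trans (IH1 _ X1 (fun s => Y s * (1 - m^-1)) Y1 _) _; last first.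
  apply: avg_le => s _; rewrite /X1.
  have -> : #|J'|%:R = #|J''|%:R - n.+1%:R :> R.
    by rewrite -e cardsD (setIidPr sJ) natrB ?subset_leq_card//; ring.
  rewrite -natr1 le_eqVlt; apply/orP; left; apply/eqP; field.
  exact: lt0r_neq0.
move=> s s1 sJ'' s1J ss1.
have -> : X1 s + Y s * (1 - m^-1) * #|Fx s :\: Fx s1|%:R =
  avg (~: J') (fun c => X s + Y s * #|Fx s :\: Fx (tperm a c * s1)%g|%:R).
  rewrite avgD avg_cst // avgZ avg_loss //; last first.
    by apply: subset_trans sJ1 _; move: sJ''; rewrite inE.
  by rewrite -/m /X1; ring.
apply: avg_le => c; rewrite inE => cJ'.
have aF : a \in Fx s1 by apply/FxP/(pfixP _ _ s1J); rewrite setU11.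
apply: HXY => //.
  apply/pfixP => x xJ; rewrite permM tpermD.
  - by apply: (pfixP _ _ s1J); rewrite setU1r.
  - by apply: contraNneq aJ' => ->.
  - by apply: contraNneq cJ' => ->.
apply: leq_trans ss1; have [->|ca] := eqVneq c a.
  by rewrite tperm1 mul1g.
by rewrite Fx_tperm_mul // subset_leq_card // subsetDl.
Qed.

End Transport.

(** * Conjugation of permutations *)

Section Conjugation.
Context {R : realFieldType} {k : nat}.
Implicit Types (s p : {perm 'I_k}) (J : {set 'I_k}).

Lemma Fx_conj s p : Fx (s ^ p)%g = p @: Fx s.
Proof.
apply/setP => x; rewrite -[x](permKV p) mem_imset; last exact: perm_inj.
by rewrite !inE permJ (inj_eq perm_inj).
Qed.

Lemma avg_pfix_conj (H : {perm 'I_k} -> R) p J :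
  avg (pfix (p @: J)) H = avg (pfix J) (fun s => H (s ^ p)%g).
Proof.
have memJ s : (s ^ p)%g \in pfix (p @: J) = (s \in pfix J).
  rewrite !inE Fx_conj; apply/subsetP/subsetP => sub x xJ.
    by rewrite -(mem_imset _ _ (@perm_inj _ p)) sub // imset_f.
  by case/imsetP: xJ => y yJ ->; rewrite imset_f // sub.
rewrite /avg (reindex_inj (conjg_inj p)) /=.
congr (_ / _); first exact: eq_bigl.
congr (_%:R); rewrite -!sum1_card (reindex_inj (conjg_inj p)) /=.
exact: eq_bigl.
Qed.

End Conjugation.

(** * Stabilizers of arbitrary sets and functions of the fixed set *)

Section General.
Context {R : realFieldType} {k : nat}.
Implicit Types (s t : {perm 'I_k}) (J B F G : {set 'I_k}).

(** Induction on [#|J' :\: J''|]: conjugation by a transposition exchanges some [b] in [J' :\: J'']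
    for some [a] in [J'' :\: J'], at the price of at most one more lost point. *)
Lemma transport J' J'' : (#|J'| <= #|J''|)%N ->
  exists2 kap : R, 0 <= kap <= 1 &
  forall (H X Y : {perm 'I_k} -> R),
    (forall s, 0 <= Y s) ->
    (forall s t, s \in pfix J'' -> t \in pfix J' -> (#|Fx t| <= #|Fx s|)%N ->
       H t <= X s + Y s * #|Fx s :\: Fx t|%:R) ->
  avg (pfix J') H <=
  avg (pfix J'') (fun s => X s + Y s * (#|J'' :\: J'|%:R
                      + (#|Fx s|%:R - #|J''|%:R - 1) * kap)).
Proof.
move e : #|J' :\: J''| => r; elim: r J' e => [|r IH] J' e leJ.
  by apply: transport_nested; rewrite -setD_eq0 -cards_eq0 e.
have /card_gt0P[b] : (0 < #|J' :\: J''|)%N by rewrite e.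
rewrite inE => /andP[bJ'' bJ'].
have /card_gt0P[a] : (0 < #|J'' :\: J'|)%N.
  move: leJ; rewrite -(cardsID J'' J') -(cardsID J' J'') setIC leq_add2l e.
  exact: leq_trans.
rewrite inE => /andP[aJ' aJ''].
set p := tperm a b; pose J1 := p @: J'.
have pK : p @: J1 = J'.
  rewrite -imset_comp -[RHS]imset_id; apply: eq_imset => x /=.
  exact: tpermK.
have J1E : J1 = a |: (J' :\ b).
  apply/setP => x; rewrite -[x](tpermK a b) -/p; move: (p x) => {}x.
  rewrite mem_imset; last exact: perm_inj.
  rewrite !inE /p; case: tpermP => [->|->|/eqP/negbTE xa /eqP/negbTE xb].
  - by rewrite (negbTE aJ') eqxx /= orbF; apply/esym/negbTE; apply: contraNneq bJ'' => ->.
  - by rewrite bJ' eqxx.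
  - by rewrite xa xb.
have e1 : #|J1 :\: J''| = r.
  move: e; rewrite (cardsD1 b) inE bJ' bJ'' => -[<-]; congr #|pred_of_set _|.
  apply/setP => x; rewrite J1E !inE; case: eqVneq => [->|_] /=.
    by rewrite aJ'' (negbTE aJ') !andbF.
  by rewrite andbCA.
have c1 : (#|J1| <= #|J''|)%N by rewrite card_imset //; exact: perm_inj.
have eD : #|J'' :\: J'| = #|J'' :\: J1|.+1.
  rewrite (cardsD1 a) inE aJ' aJ''; congr _.+1; congr #|pred_of_set _|.
  apply/setP => x; rewrite J1E !inE negb_or andbA.
  by case: (eqVneq x b) => [->|_] //=; rewrite (negbTE bJ'') !andbF.
have [kap kap01 IH1] := IH _ e1 c1; exists kap => // H X Y Y0 HXY.
rewrite -pK avg_pfix_conj.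
(* The extra [Y s] pays for [a], the only point that conjugation by [p] can remove from [Fx t]. *)
apply: le_trans (IH1 _ (fun s => X s + Y s) Y Y0 _) _; last first.
  apply: avg_le => s _; rewrite pK eD -natr1 le_eqVlt; apply/orP; left.
  by apply/eqP; ring.
move=> s t sJ'' tJ1 ts.
have cF : #|Fx (t ^ p)%g| = #|Fx t| by rewrite Fx_conj card_imset //; exact: perm_inj.
apply: le_trans (HXY s (t ^ p)%g sJ'' _ _) _; last 1 first.
- rewrite -addrA lerD2l -{2}[Y s]mulr1 -mulrDr ler_wpM2l // nat1r ler_nat.
  apply: (@leq_trans #|a |: Fx s :\: Fx t|); last first.
    by rewrite cardsU1; case: (_ \notin _).
  apply: subset_leq_card; apply/subsetP => x; rewrite Fx_conj in_setD => /andP[xt xs].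
  rewrite in_setU1 in_setD xs andbT; case: (eqVneq x a) => //= xa.
  case: (eqVneq x b) xt => [->|xb].
    case/negP; apply/imsetP; exists a; last by rewrite tpermL.
    by apply/FxP/(pfixP _ _ tJ1); rewrite J1E setU11.
  by apply: contraNN => xt; apply/imsetP; exists x => //; rewrite tpermD // eq_sym.
- rewrite -pK inE Fx_conj; move: tJ1; rewrite inE; exact: imsetS.
- by rewrite cF.
Qed.

Definition gA (h : {set 'I_k} -> R) J : R := avg (pfix J) (fun s => h (Fx s)).

(** For [x] in [J], the probability that a uniform point of the next fixed set is [x]. *)
Definition ell J : R := avg (pfix J) (fun s => #|Fx s|%:R^-1).

Definition lip L (h : {set 'I_k} -> R) := forall F G, F != set0 ->
  (#|F| <= #|G|)%N -> `|h F - h G| <= L * (#|G :\: F|%:R / #|G|%:R).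

Lemma gA_le L h J' J'' : 0 <= L -> J' != set0 -> (#|J'| <= #|J''|)%N ->
  (forall F G, F != set0 -> (#|F| <= #|G|)%N ->
    h F <= h G + L * (#|G :\: F|%:R / #|G|%:R)) ->
  gA h J' <= gA h J'' + L * #|J'' :\: J'|%:R * ell J''.
Proof.
move=> L0 J'0 leJ hL.
have [kap /andP[kap0 kap1] /(_ (h \o @Fx k) (h \o @Fx k)
  (fun s => L / #|Fx s|%:R))] := transport _ _ leJ.
move=> /(_ _ _)/le_trans; apply.
- by move=> s; rewrite divr_ge0.
- move=> s t _ tJ ts /=; apply: le_trans (hL _ (Fx s) _ ts) _.
    have /set0Pn[x xJ] := J'0; apply/set0Pn; exists x.
    exact/FxP/(pfixP _ _ tJ).
  by rewrite mulrA mulrAC.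
rewrite avgD lerD2l.
set N : R := #|J''|%:R; set e : R := #|J'' :\: J'|%:R.
have N0 : 0 <= N by [].
(* With [f = #|Fx s|] and [m = N + 1], [(f - m) / f <= (f - m) / m]. The right side is linear in
   [f], and its mean is zero, or negative when [J''] is everything, so [kap] disappears. *)
apply: (@le_trans _ _ (avg (pfix J'')
   (fun s => L * e * #|Fx s|%:R^-1 + L * kap / (N + 1) * (#|Fx s|%:R - (N + 1))))).
  apply: avg_le => s sJ; set f : R := #|Fx s|%:R.
  have f0 : 0 < f.
    rewrite ltr0n (leq_trans _ (card_Fx_ge _ _ sJ)) // (leq_trans _ leJ) //.
    by rewrite card_gt0.
  rewrite -subr_ge0.
  have -> : L * e * f^-1 + L * kap / (N + 1) * (f - (N + 1)) -
      L / f * (e + (f - N - 1) * kap) = L * kap * ((f - (N + 1)) ^+ 2 / ((N + 1) * f)).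
    by field; rewrite lt0r_neq0 //= lt0r_neq0 // ltr_wpDl.
  apply: mulr_ge0; first exact: mulr_ge0.
  by rewrite divr_ge0 ?sqr_ge0 // mulr_ge0 ?addr_ge0 // ltW.
rewrite avgD !avgZ gerDl mulr_ge0_le0 //.
  by rewrite !mulr_ge0 ?invr_ge0 ?addr_ge0.
rewrite avgD avg_cst ?pfix_neq0 //.
have [JT|JT] := eqVneq J'' setT; last by rewrite avg_card_Fx // -natr1 subrr.
rewrite (@eq_avg _ _ _ _ (fun=> N)) => [|s].
  by rewrite avg_cst ?pfix_neq0 //; lra.
by rewrite /N JT inE subTset => /eqP ->.
Qed.

Lemma gA_lip L h J' J'' : 0 <= L -> J' != set0 -> (#|J'| <= #|J''|)%N ->
  lip L h -> `|gA h J' - gA h J''| <= L * #|J'' :\: J'|%:R * ell J''.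
Proof.
move=> L0 J'0 leJ hL; rewrite ler_distl; apply/andP; split; last first.
  apply: gA_le => // F G F0 FG.
  by have := hL F G F0 FG; rewrite ler_distl => /andP[].
have := @gA_le L (fun F => - h F) J' J'' L0 J'0 leJ.
rewrite /gA !avgN; set x := avg _ _; set y := avg _ _ => H.
suff : - x <= - y + L * #|J'' :\: J'|%:R * ell J'' by lra.
apply: H => F G F0 FG; have := hL F G F0 FG; rewrite ler_distl => /andP[]; lra.
Qed.

Lemma ell_conj (p : {perm 'I_k}) J : ell (p @: J) = ell J.
Proof.
rewrite /ell avg_pfix_conj; apply: eq_avg => s _.
by rewrite Fx_conj card_imset //; exact: perm_inj.
Qed.

Lemma ell_ge0 J : 0 <= ell J.
Proof. by apply: avg_ge0 => s _; rewrite invr_ge0. Qed.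

Lemma ellT : ell setT = k%:R^-1.
Proof.
rewrite /ell (@eq_avg _ _ _ _ (fun=> k%:R^-1)) ?avg_cst ?pfix_neq0 // => s.
by rewrite inE subTset => /eqP ->; rewrite cardsT card_ord.
Qed.

(** As a function of [f], [N / f] is convex, so on [[N, k]] it lies below its chord
    [1 + (N - f) / k]; the mean of [f] is [N + 1]. *)
Lemma card_ell_le J : J != setT -> J != set0 ->
  #|J|%:R * ell J <= 1 - k%:R^-1.
Proof.
move=> JT J0; rewrite /ell -avgZ.
set N : R := #|J|%:R.
have N0 : 0 < N by rewrite ltr0n card_gt0.
have k0 : 0 < k%:R :> R.
  by apply: lt_le_trans N0 _; rewrite ler_nat -[X in (_ <= X)%N]card_ord max_card.
apply: (@le_trans _ _ (avg (pfix J) (fun s => 1 + k%:R^-1 * (N - #|Fx s|%:R)))).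
  apply: avg_le => s sJ; set f : R := #|Fx s|%:R.
  have Nf : N <= f by rewrite ler_nat card_Fx_ge.
  have fk : f <= k%:R by rewrite ler_nat -[X in (_ <= X)%N]card_ord max_card.
  have f0 : 0 < f by apply: lt_le_trans Nf.
  rewrite -subr_ge0.
  have -> : 1 + k%:R^-1 * (N - f) - N / f = (f - N) * (k%:R - f) / (k%:R * f).
    by field; rewrite !lt0r_neq0.
  by rewrite divr_ge0 ?mulr_ge0 ?subr_ge0 // ltW.
rewrite avgD avg_cst ?pfix_neq0 // avgZ avgD avg_cst ?pfix_neq0 // avgN.
by rewrite avg_card_Fx // -natr1 opprD addNKr mulrN1.
Qed.

End General.

(** * Occupied sets *)

Section Occupancy.
Context {R : realFieldType} {T : finType}.
Implicit Types (F G J : {set T}) (g : {set T} -> R).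

(** Product coupling: times the common mass, both sides are sums over pairs weighted by
    [al x * be y]. *)
Lemma sum_le_transport (A B : {set T}) (al be a b : T -> R) :
  {in A, forall x, 0 <= al x} -> {in B, forall y, 0 <= be y} ->
  \sum_(x in A) al x = \sum_(y in B) be y ->
  {in A & B, forall x y, a x <= b y} ->
  \sum_(x in A) al x * a x <= \sum_(y in B) be y * b y.
Proof.
move=> al0 be0 eW ab; have [W0|W0] := eqVneq (\sum_(x in A) al x) 0.
  rewrite big1 ?big1 // => x xA.
    by rewrite (psumr_eq0P be0 _ xA) ?mul0r // -eW.
  by rewrite (psumr_eq0P al0 W0 xA) mul0r.
have {}W0 : 0 < \sum_(x in A) al x by rewrite lt0r W0 sumr_ge0.
rewrite -(ler_pM2l W0) {1}eW !mulr_suml.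
under [X in X <= _]eq_bigr do rewrite mulr_sumr.
rewrite exchange_big /=; apply: ler_sum => x xA.
rewrite mulr_sumr; apply: ler_sum => y yB.
by rewrite mulrCA ler_wpM2l ?al0 // ler_wpM2l ?be0 // ab.
Qed.

Definition occ_le F J' J'' := (J'' :&: F \subset J') && (#|J'| <= #|J''|)%N.

Definition dominated F G g g'' := forall J' J'', J' != set0 ->
  J' \subset F -> J'' \subset G -> occ_le F J' J'' -> g J' <= g'' J''.

(* Dual form of a one-ball coupling. A ball of [G] falling in the set [A] of points
   of [F :&: G] not in [J'] goes to the same place in [F]. If [#|J'| = #|J''|],
   moreover, a ball of [F] outside [J'] and not so matched requires the ball of
   [G] to be outside [J'']; there is enough mass for this as [#|F| <= #|G|]. *)
Lemma dominated_step F G g g'' J' J'' : F != set0 -> (#|F| <= #|G|)%N ->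
  dominated F G g g'' ->
  J' \subset F -> J'' \subset G -> occ_le F J' J'' ->
  avg F (fun x => g (x |: J')) <= avg G (fun y => g'' (y |: J'')).
Proof.
move=> F0 leFG dom J'F J''G /andP[JFJ leJ].
set a := fun x => g (x |: J'); set b := fun y => g'' (y |: J'').
pose A := (F :&: G) :\: J'.
(* With equal cardinals, balls falling in [J'] and in [J''] are paired together; otherwise
   [#|J'| < #|J''|], and one ball cannot break the inequality. *)
pose C' := if #|J'| == #|J''| then J' else set0.
pose C'' := if #|J'| == #|J''| then J'' else set0.
have C'J : C' \subset J' by rewrite /C'; case: ifP; rewrite ?sub0set.
have C''J : C'' \subset J'' by rewrite /C''; case: ifP; rewrite ?sub0set.
have cC : #|C'| = #|C''| by rewrite /C' /C''; case: eqP.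
have AF : A \subset F by rewrite subDset (subset_trans (subsetIl _ _)) // subsetUr.
have AG : A \subset G by rewrite subDset (subset_trans (subsetIr _ _)) // subsetUr.
have C'F := subset_trans C'J J'F; have C''G := subset_trans C''J J''G.
have AC' x : x \in A -> x \notin C'.
  by rewrite inE => /andP[xJ _]; apply: contraNN xJ; apply: subsetP.
have AC'' x : x \in A -> x \notin C''.
  rewrite !inE => /and3P[xJ xF _]; apply: contraNN xJ => /(subsetP C''J) xJ''.
  by apply: (subsetP JFJ); rewrite inE xJ''.
have domU x y : x \in F -> y \in G -> (y \in F -> y \in x |: J') ->
   (#|x |: J'| <= #|y |: J''|)%N -> a x <= b y.
  move=> xF yG yFJ lec; apply: dom.
  - by apply/set0Pn; exists x; rewrite setU11.
  - by rewrite subUset sub1set xF.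
  - by rewrite subUset sub1set yG.
  - rewrite /occ_le lec andbT; apply/subsetP => z; rewrite in_setI in_setU1.
    case: eqVneq => [->|_] /=; first exact: yFJ.
    by move=> zJF; apply: setU1r; apply: (subsetP JFJ); rewrite inE.
have f0 : 0 < #|F|%:R :> R by rewrite ltr0n card_gt0.
have fg : #|F|%:R <= #|G|%:R :> R by rewrite ler_nat.
have g0 : 0 < #|G|%:R :> R by apply: lt_le_trans fg.
set f : R := #|F|%:R in f0 fg *; set gg : R := #|G|%:R in fg g0 *.
rewrite /avg -/f -/gg ler_pdivrMr // mulrAC ler_pdivlMr // -/f mulrC [leRHS]mulrC.
(* With denominators cleared, a point of [F] weighs [#|G|] and a point of [G] weighs [#|F|]. [al x]
   is the weight left once [A] is matched with itself and [C'] with [C'']; its total is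
   [#|F| * #|Y|]. *)
pose al x : R := gg - f * (x \in A)%:R - f * (x \in C')%:R.
pose Y := G :\: (A :|: C'').
have sumI (B B' : {set T}) (h : T -> R) : B \subset B' ->
    \sum_(x in B') (x \in B)%:R * h x = \sum_(x in B) h x.
  move=> /setIidPr <-; rewrite [RHS]big_mkcond [LHS]big_mkcond /=.
  apply: eq_bigr => x _; rewrite inE; case: (x \in B') => //=.
  by case: (x \in B); rewrite ?mul1r ?mul0r.
have sumIc (B B' : {set T}) : B \subset B' ->
    \sum_(x in B') (x \in B)%:R = #|B|%:R :> R.
  move/(sumI _ _ (fun=> 1)); under eq_bigr do rewrite mulr1.
  by move=> ->; rewrite sum_cst mulr1.
have -> : gg * \sum_(x in F) a x =
   \sum_(x in F) al x * a x + f * \sum_(x in A) a x + f * \sum_(x in C') a x.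
  rewrite -(sumI _ _ a AF) -(sumI _ _ a C'F) !mulr_sumr -!big_split /=.
  apply: eq_bigr => x _.
  have split3 (p q z : R) : gg * z = (gg - f * p - f * q) * z + f * (p * z) + f * (q * z).
    by ring.
  exact: split3.
have YG : Y \subset G by exact: subsetDl.
have -> : f * \sum_(y in G) b y =
   \sum_(y in Y) f * b y + f * \sum_(y in A) b y + f * \sum_(y in C'') b y.
  rewrite -mulr_sumr -(sumI _ _ b YG) -(sumI _ _ b AG) -(sumI _ _ b C''G).
  rewrite !mulr_sumr -!big_split /=; apply: eq_bigr => y yG.
  rewrite [y \in Y]inE yG andbT inE; have [yA|yA] /= := boolP (y \in A).
    by rewrite (negbTE (AC'' _ yA)) !(mulr0n, mulr1n) !(mul0r, mulr0, mul1r) add0r addr0.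
  by case: (y \in C'') => /=; rewrite !(mulr0n, mulr1n) !(mul0r, mulr0, mul1r) ?add0r ?addr0.
have card_new x y : y \in Y -> (#|x |: J'| <= #|y |: J''|)%N.
  rewrite !inE negb_or => /andP[/andP[_ yC] _]; rewrite !cardsU1.
  move: leJ yC; rewrite leq_eqVlt /C''; case: eqVneq => /= [-> _ -> /=|_ ltJ _].
    by rewrite leq_add2r; case: (_ \notin _).
  apply: leq_trans (leq_trans ltJ (leq_addl _ _)); rewrite -add1n leq_add2r.
  by case: (_ \notin _).
apply: lerD; [apply: lerD|].
- apply: sum_le_transport => [x xF|y _||x y xF yY].
  + rewrite /al; have [xA|xA] := boolP (x \in A).
      by rewrite (negbTE (AC' _ xA)) mulr1 mulr0 subr0 subr_ge0.
    rewrite mulr0 subr0 subr_ge0; case: (x \in C') => /=; rewrite ?mulr1 ?mulr0 //.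
  + exact: ltW.
  + rewrite /al !sumrB -!mulr_sumr !sumIc // !sum_cst -/f -/gg.
    have -> : #|Y|%:R = gg - #|A|%:R - #|C''|%:R :> R.
      rewrite -(sumIc _ _ YG) -(sumIc _ _ AG) -(sumIc _ _ C''G).
      rewrite -[gg]mulr1 /gg -sum_cst -!sumrB.
      apply: eq_bigr => y yG.
      rewrite [y \in Y]inE yG andbT inE; have [yA|yA] /= := boolP (y \in A).
        by rewrite (negbTE (AC'' _ yA)) !(mulr0n, mulr1n) subrr subr0.
      by case: (y \in C'') => /=; rewrite !(mulr0n, mulr1n) ?subr0 ?subrr.
    by rewrite cC; ring.
  + apply: domU => //; first exact: (subsetP YG).
      move=> yF; apply: setU1r; move: yY; rewrite !inE yF /= !negb_or.
      by case: (y \in J') => //= /andP[/andP[]]; rewrite ?andbT => /negbTE ->.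
    exact: card_new.
- apply: ler_wpM2l; first exact: ltW.
  apply: ler_sum => x xA.
  have xF := subsetP AF _ xA.
  apply: domU => //; first exact: (subsetP AG).
    by rewrite setU11.
  rewrite !cardsU1; move: (xA); rewrite !inE => /and3P[-> _ _] /=.
  suff -> : x \notin J'' by rewrite leq_add2l.
  move: xA; rewrite !inE => /and3P[xJ _ _]; apply: contraNN xJ => xJ.
  by apply: (subsetP JFJ); rewrite inE xJ.
- apply: ler_wpM2l; first exact: ltW.
  have mul1 (B : {set T}) h : \sum_(x in B) h x = \sum_(x in B) 1 * h x :> R.
    by apply: eq_bigr => x _; rewrite mul1r.
  rewrite (mul1 C') (mul1 C''); apply: sum_le_transport => // [|x y xC yC].
    by rewrite !sum_cst cC.
  have xJ := subsetP C'J _ xC; have yJ := subsetP C''J _ yC.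
  apply: domU; [exact: (subsetP J'F)|exact: (subsetP J''G)| |].
    by move=> yF; apply: setU1r; apply: (subsetP JFJ); rewrite inE yJ.
  by rewrite !(setUidPr _) ?sub1set.
Qed.

(** Balls thrown one at a time on top of an occupied set [J], a form of the average over [fpow n F]
    suited to coupling ball by ball. *)
Fixpoint iavg n F g J : R :=
  if n is n'.+1 then avg F (fun x => iavg n' F g (x |: J)) else g J.

Lemma iavg_le n F G g g'' J' J'' : F != set0 -> (#|F| <= #|G|)%N ->
  dominated F G g g'' -> (0 < n)%N || (J' != set0) ->
  J' \subset F -> J'' \subset G -> occ_le F J' J'' ->
  iavg n F g J' <= iavg n G g'' J''.
Proof.
move=> F0 FG dom; elim: n J' J'' => [|n IH] J' J'' /= nJ J'F J''G occ.
  exact: dom.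
apply: (@dominated_step F G (iavg n F g) (iavg n G g'')) => //.
by move=> S' S'' S'0 S'F S''G occS; apply: IH => //; rewrite S'0 orbT.
Qed.

Implicit Types (n : nat).

Definition im n (v : {ffun 'I_n -> T}) : {set T} := [set v i | i : 'I_n].

Definition fpow n F : {set {ffun 'I_n -> T}} := [set v | im n v \subset F].

Lemma im_subP n (v : {ffun 'I_n -> T}) F :
  reflect (forall i, v i \in F) (im n v \subset F).
Proof.
apply: (iffP subsetP) => [sub i|vF x /imsetP[i _ ->] //].
by apply: sub; apply: imset_f.
Qed.

Lemma card_fpow n F : #|fpow n F| = (#|F| ^ n)%N.
Proof.
rewrite -[in RHS](card_ord n) -card_ffun_on; apply: eq_card => v.
by rewrite inE; apply/im_subP/ffun_onP.
Qed.

Definition consf n (p : T * {ffun 'I_n -> T}) : {ffun 'I_n.+1 -> T} :=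
  [ffun i => oapp p.2 p.1 (unlift ord0 i)].

Definition unconsf n (v : {ffun 'I_n.+1 -> T}) : T * {ffun 'I_n -> T} :=
  (v ord0, [ffun i => v (lift ord0 i)]).

Lemma consfK n : cancel (consf n) (unconsf n).
Proof.
move=> [x w]; congr pair; first by rewrite ffunE unlift_none.
by apply/ffunP => i; rewrite !ffunE liftK.
Qed.

Lemma unconsfK n : cancel (unconsf n) (consf n).
Proof.
move=> v; apply/ffunP => i; rewrite ffunE /=.
by case: unliftP => [j ->|->] /=; rewrite ?ffunE.
Qed.

Lemma im_consf n x (w : {ffun 'I_n -> T}) : im n.+1 (consf n (x, w)) = x |: im n w.
Proof.
apply/setP => y; rewrite in_setU1; apply/imsetP/orP.
  case=> i _ ->; rewrite ffunE; case: unliftP => [j _|_] /=; last by left.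
  by right; apply: imset_f.
case=> [/eqP ->|/imsetP[j _ ->]].
  by exists ord0; rewrite // ffunE unlift_none.
by exists (lift ord0 j); rewrite // ffunE liftK.
Qed.

Lemma avg_fpowS n F (phi : {ffun 'I_n.+1 -> T} -> R) :
  avg (fpow n.+1 F) phi =
  avg F (fun x => avg (fpow n F) (fun w => phi (consf n (x, w)))).
Proof.
rewrite /avg !card_fpow expnSr natrM invfM mulrA -!mulr_suml; congr (_ * _ * _).
rewrite (reindex (consf n)) /=; last first.
  by exists (unconsf n) => p _; rewrite ?consfK ?unconsfK.
rewrite pair_big_dep /=; apply: eq_big => [[x w]|[x w] //].
by rewrite !inE im_consf subUset sub1set.
Qed.

Lemma avg_fpow n F g J : F != set0 ->
  avg (fpow n F) (fun v => g (im n v :|: J)) = iavg n F g J.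
Proof.
move=> F0; elim: n J => [|n IH] J /=.
  have im0 (v : {ffun 'I_0 -> T}) : im 0 v = set0.
    by apply/setP => x; rewrite inE; apply/imsetP => -[[]].
  rewrite (@eq_avg _ _ _ _ (fun=> g J)) => [|v _]; last by rewrite im0 set0U.
  by rewrite avg_cst // -cards_eq0 card_fpow expn0.
rewrite avg_fpowS; apply: eq_avg => x _; rewrite -IH; apply: eq_avg => w _.
by rewrite im_consf setUCA setUA.
Qed.

End Occupancy.

(** * Contraction *)

Section Contraction.
Context {R : realFieldType} {n k : nat}.
Hypotheses (n_gt0 : (0 < n)%N) (le_nk : (n <= k)%N).
Implicit Types (F G J : {set 'I_k}) (v : {ffun 'I_n -> 'I_k}).

Let k_gt0 : (0 < k)%N. Proof. exact: leq_trans le_nk. Qed.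
Let kR_gt0 : 0 < k%:R :> R. Proof. by rewrite ltr0n. Qed.

Lemma im_neq0 v : im n v != set0.
Proof. by apply/set0Pn; exists (v (Ordinal n_gt0)); apply: imset_f. Qed.

Lemma fpow_neq0 F : F != set0 -> fpow n F != set0.
Proof. by rewrite -!card_gt0 card_fpow expn_gt0 => ->. Qed.

(** As [n <= k], all values occur only if [v] is a bijection; copying one coordinate over another
    injects these [v] into the remaining ones. *)
Lemma avg_onto_le G : (1 < k)%N -> G != set0 ->
  avg (fpow n G) (fun v => (im n v == setT)%:R) <= 2^-1 :> R.
Proof.
move=> k1 G0; pose S := [set v in fpow n G | im n v == setT].
have -> : avg (fpow n G) (fun v => (im n v == setT)%:R) = #|S|%:R / #|fpow n G|%:R :> R.
  congr (_ / _); rewrite card_sum_mem big_mkcond /=; apply: eq_bigr => v _.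
  by rewrite !inE; case: (_ \subset G).
have N0 : 0 < #|fpow n G|%:R :> R by rewrite ltr0n card_gt0 fpow_neq0.
rewrite ler_pdivrMr // mulrC ler_pdivlMr ?ltr0n // -natrM ler_nat muln2 -addnn.
have [->|[v0]] := set_0Vmem S; first by rewrite cards0.
have Sinj v : v \in S -> n = k /\ injective v.
  rewrite inE => /andP[_ /eqP vT].
  have cT : #|im n v| = k by rewrite vT cardsT card_ord.
  have nk : n = k.
    apply/eqP; rewrite eqn_leq le_nk -[X in (X <= _)%N]cT.
    by rewrite -[X in (_ <= X)%N]card_ord leq_imset_card.
  split => // i j; have /imset_injP : #|im n v| == #|'I_n| by rewrite cT card_ord nk.
  exact.
case/Sinj => nk _; have n1 : (1 < n)%N by rewrite nk.
pose i0 := Ordinal n_gt0; pose i1 := Ordinal n1.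
pose Phi v : {ffun 'I_n -> 'I_k} := [ffun i => v (if i == i1 then i0 else i)].
(* The overwritten value is the only one missing from [Phi v]. *)
have Phi_inj : {in S &, injective Phi}.
  move=> v w vS wS /ffunP eq_vw; have [_ vinj] := Sinj v vS.
  have off i : i != i1 -> v i = w i.
    by move=> ni; have := eq_vw i; rewrite !ffunE (negbTE ni).
  apply/ffunP => i; have [->|/off//] := eqVneq i i1.
  have : v i1 \in im n w by move: wS; rewrite inE => /andP[_ /eqP ->]; rewrite inE.
  case/imsetP => j _ vj; have [ji|/off wj] := eqVneq j i1; first by rewrite vj ji.
  by move: vj; rewrite -wj => /vinj ->.
have sub : Phi @: S \subset fpow n G :\: S.
  apply/subsetP => _ /imsetP[v vS ->]; rewrite inE; apply/andP; split.
    apply/negP => /Sinj[_ /(_ i0 i1)]; rewrite !ffunE /= => /(_ erefl) e01.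
    by have := congr1 val e01.
  rewrite inE; apply/im_subP => i; rewrite ffunE.
  by move: vS; rewrite !inE => /andP[/im_subP].
have sS : S \subset fpow n G by apply/subsetP => v; rewrite inE => /andP[].
rewrite -{1}(card_in_imset Phi_inj).
apply: leq_trans (leq_add (subset_leq_card sub) (leqnn _)) _.
by rewrite cardsD (setIidPr sS) subnK // subset_leq_card.
Qed.

(** [card_ell_le] saves [1/k] unless all values occur, where the product is exactly 1. *)
Lemma avg_card_ell_le G : (1 < k)%N -> G != set0 ->
  avg (fpow n G) (fun v => #|im n v|%:R * ell (im n v)) <= 1 - (2 * k%:R)^-1 :> R.
Proof.
move=> k1 G0; pose q v : R := (im n v == setT)%:R.
apply: (@le_trans _ _ (avg (fpow n G) (fun v => (1 - k%:R^-1) + k%:R^-1 * q v))).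
  apply: avg_le => v _; rewrite /q; have [->|vT] := eqVneq (im n v) setT.
    by rewrite ellT cardsT card_ord mulfV ?lt0r_neq0 // mulr1 subrK.
  by rewrite mulr0 addr0 card_ell_le // im_neq0.
rewrite avgD avg_cst ?fpow_neq0 // avgZ.
have ik : 0 <= k%:R^-1 :> R by rewrite invr_ge0 ltW.
have := ler_wpM2l ik (avg_onto_le G k1 G0).
by rewrite -/q invfM; lra.
Qed.

(* By symmetry, each point of [G] contributes equally to the average of
   [#|im v| * ell (im v)]. *)
Lemma avg_cardD_ell F G : G != set0 ->
  avg (fpow n G) (fun v => #|im n v :\: F|%:R * ell (im n v)) =
  #|G :\: F|%:R / #|G|%:R *
  avg (fpow n G) (fun v => #|im n v|%:R * ell (im n v)) :> R.
Proof.
move=> G0; pose e x : R := avg (fpow n G) (fun v => (x \in im n v)%:R * ell (im n v)).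
have e_sym x y : x \in G -> y \in G -> e x = e y.
  move=> xG yG; pose p := tperm x y.
  pose P v : {ffun 'I_n -> 'I_k} := [ffun i => p (v i)].
  have PK : involutive P by move=> v; apply/ffunP => i; rewrite !ffunE tpermK.
  have imP v : im n (P v) = p @: im n v.
    by rewrite /im -imset_comp; apply: eq_imset => i; rewrite ffunE.
  have pG z : z \in G -> p z \in G by rewrite /p; case: tpermP => // ->.
  rewrite /e /avg; congr (_ / _); rewrite (reindex_inj (inv_inj PK)) /=.
  apply: eq_big => v.
    rewrite !inE; apply/im_subP/im_subP => vG i; have := vG i; rewrite ?ffunE.
      by move/pG; rewrite tpermK.
    exact: pG.
  by move=> _; rewrite imP ell_conj -(tpermR x y) -/p mem_imset //; exact: perm_inj.
have sum_e (A : {set 'I_k}) : A \subset G ->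
  avg (fpow n G) (fun v => #|im n v :&: A|%:R * ell (im n v)) = \sum_(x in A) e x.
  move=> AG; rewrite /e /avg -mulr_suml; congr (_ / _).
  rewrite exchange_big /=; apply: eq_bigr => v _; rewrite -mulr_suml; congr (_ * _).
  rewrite card_sum_mem [RHS]big_mkcond /=; apply: eq_bigr => x _.
  by rewrite inE andbC; case: (x \in A).
have /set0Pn[x0 x0G] := G0.
have sum_e' (A : {set 'I_k}) : A \subset G ->
  avg (fpow n G) (fun v => #|im n v :&: A|%:R * ell (im n v)) = #|A|%:R * e x0.
  move=> AG; rewrite sum_e // -sum_cst; apply: eq_bigr => x xA.
  by apply: e_sym => //; apply: (subsetP AG).
have -> : avg (fpow n G) (fun v => #|im n v :\: F|%:R * ell (im n v)) = #|G :\: F|%:R * e x0.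
  rewrite -sum_e' ?subsetDl //; apply: eq_avg => v; rewrite inE => vG.
  by rewrite setIDA (setIidPl vG).
have -> : avg (fpow n G) (fun v => #|im n v|%:R * ell (im n v)) = #|G|%:R * e x0.
  rewrite -sum_e' //; apply: eq_avg => v; rewrite inE => vG.
  by rewrite (setIidPl vG).
by rewrite -mulrA mulKf // card_neq0.
Qed.

(** The balls are compared by [iavg_le], the permutations drawn next by [gA_lip]. *)
Lemma lip_step (L : R) (h : {set 'I_k} -> R) : 0 <= L -> lip L h ->
  lip (L * (1 - (2 * k%:R)^-1)) (fun F => avg (fpow n F) (fun v => gA h (im n v))).
Proof.
move=> L0 hL F G F0 leFG; have G0 : G != set0.
  by rewrite -card_gt0 (leq_trans _ leFG) // card_gt0.
(* The case [k = 1] is separate, because the single value always occurs and [avg_onto_le] fails. *)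
have sameT : k = 1%N -> F = G.
  move=> k1; have full (A : {set 'I_k}) : A != set0 -> A = setT.
    move=> A0; apply/eqP; rewrite eqEcard subsetT cardsT card_ord.
    by rewrite [X in (X <= _)%N]k1 card_gt0.
  by rewrite (full F) // (full G).
have [k1|k1] := leqP k 1.
  rewrite sameT; last by apply/eqP; rewrite eqn_leq k1.
  by rewrite subrr normr0 setDv cards0 mulr0n mul0r mulr0.
(* [occ_le] gives [#|J'' :\: J'| <= #|J'' :\: F|], a bound free of [J'], as [dominated] requires. *)
pose bd J := L * (#|J :\: F|%:R * ell J) : R.
have key (g : {set 'I_k} -> R) :
    (forall J' J'', J' != set0 -> (#|J'| <= #|J''|)%N ->
       g J' <= g J'' + L * #|J'' :\: J'|%:R * ell J'') ->
  avg (fpow n F) (fun v => g (im n v)) <= avg (fpow n G) (fun v => g (im n v)) +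
   L * (1 - (2 * k%:R)^-1) * (#|G :\: F|%:R / #|G|%:R).
  move=> gL; have E A h' : A != set0 ->
    avg (fpow n A) (fun v => h' (im n v)) = iavg n A h' set0 :> R.
    by move=> A0; rewrite -avg_fpow //; apply: eq_avg => v _; rewrite setU0.
  apply: (@le_trans _ _ (avg (fpow n G) (fun v => g (im n v) + bd (im n v)))).
    rewrite E // (E G (fun J => g J + bd J)) //; apply: (@iavg_le _ _ n F G) => //.
    - move=> J' J'' J'0 J'F J''G /andP[JFJ leJ]; apply: le_trans (gL _ _ J'0 leJ) _.
      rewrite lerD2l /bd mulrA ler_wpM2r ?ell_ge0 // ler_wpM2l // ler_nat.
      apply: subset_leq_card; apply/subsetP => x; rewrite !inE => /andP[xJ' xJ''].
      rewrite xJ'' andbT; apply: contraNN xJ' => xF.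
      by apply: (subsetP JFJ); rewrite inE xJ'' xF.
    - by rewrite n_gt0.
    - exact: sub0set.
    - exact: sub0set.
    - by rewrite /occ_le set0I sub0set leqnn.
  rewrite avgD lerD2l avgZ -mulrA ler_wpM2l // avg_cardD_ell // mulrC.
  rewrite ler_wpM2r ?divr_ge0 //; exact: avg_card_ell_le.
rewrite ler_distl; apply/andP; split; last first.
  apply: key => J' J'' J'0 leJ.
  by have := gA_lip _ _ _ _ L0 J'0 leJ hL; rewrite ler_distl => /andP[].
have := key (fun J => - gA h J); rewrite !avgN => H.
rewrite lerBlDr -lerBlDl.
suff : - avg (fpow n F) (fun v => gA h (im n v)) <=
       - avg (fpow n G) (fun v => gA h (im n v)) +
       L * (1 - (2 * k%:R)^-1) * (#|G :\: F|%:R / #|G|%:R) by lra.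
apply: H => J' J'' J'0 leJ.
have := gA_lip _ _ _ _ L0 J'0 leJ hL; rewrite ler_distl => /andP[]; lra.
Qed.

(** [#|J'' :\: J'| * ell J''] is at most [1 - 1/k], by [card_ell_le] or, when [J''] is everything,
    because [J'] is nonempty. One of the two powers gained will pay for rounding the mixing time
    down. *)
Lemma gA_osc (L : R) h J' J'' : 0 <= L -> lip L h -> J' != set0 -> J'' != set0 ->
  `|gA h J' - gA h J''| <= L * (1 - (2 * k%:R)^-1) ^+ 2.
Proof.
wlog leJ : J' J'' / (#|J'| <= #|J''|)%N => [th L0 hL J'0 J''0|].
  have [le|/ltnW le] := leqP #|J'| #|J''|; first exact: th.
  by rewrite distrC; apply: th.
move=> L0 hL J'0 J''0; apply: le_trans (gA_lip _ _ _ _ L0 J'0 leJ hL) _.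
rewrite -mulrA ler_wpM2l //; apply: (@le_trans _ _ (1 - k%:R^-1)); last first.
  by rewrite -subr_ge0 invfM; set x := k%:R^-1; have := sqr_ge0 (2^-1 * x); nra.
have [->|J''T] := eqVneq J'' setT.
  rewrite ellT ler_pdivrMr // mulrBl mul1r mulVf ?lt0r_neq0 //.
  rewrite lerBrDr natr1 ler_nat -[X in (_ <= X)%N](card_ord k) -cardsT.
  rewrite -(cardsID J' setT) setTI -addn1 addnC leq_add2r card_gt0 //.
apply: le_trans (card_ell_le _ J''T J''0).
by rewrite ler_wpM2r ?ell_ge0 // ler_nat subset_leq_card // subsetDl.
Qed.

Lemma bernoulli (x : R) m : 0 <= x <= 1 -> 1 - x ^+ m <= m%:R * (1 - x).
Proof.
move=> /andP[x0 x1]; elim: m => [|m IH]; first by rewrite expr0 subrr mul0r.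
rewrite exprS -natr1; have := ler_wpM2l x0 IH.
have : 0 <= m%:R * (1 - x) * (1 - x) by rewrite !mulr_ge0 ?subr_ge0.
nra.
Qed.

(** Both sums share the part over [fpow n (F :&: G)], which has proportion [(1 - d)^n] in [fpow n G]
    for [d = #|G :\: F| / #|G|]; Bernoulli's inequality concludes. *)
Lemma lip_avg (phi : {ffun 'I_n -> 'I_k} -> R) : (forall v, `|phi v| <= 1) ->
  lip (2 * n%:R) (fun F => avg (fpow n F) phi).
Proof.
move=> phi1 F G F0 leFG; have G0 : G != set0.
  by rewrite -card_gt0 (leq_trans _ leFG) // card_gt0.
pose I := F :&: G.
have sum_norm (A : {set {ffun 'I_n -> 'I_k}}) : `|\sum_(v in A) phi v| <= #|A|%:R.
  apply: le_trans (ler_norm_sum _ _ _) _; rewrite -[leRHS]mulr1 -sum_cst.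
  exact: ler_sum.
have fpowS (A B : {set 'I_k}) : A \subset B -> fpow n A \subset fpow n B.
  by move=> AB; apply/subsetP => v; rewrite !inE => /subset_trans; apply.
have split_sum (A : {set 'I_k}) : I \subset A ->
    exists2 r, `|r| <= #|fpow n A|%:R - #|fpow n I|%:R &
    \sum_(v in fpow n A) phi v = \sum_(v in fpow n I) phi v + r.
  move=> IA; exists (\sum_(v in fpow n A :\: fpow n I) phi v).
    apply: le_trans (sum_norm _) _.
    by rewrite cardsD (setIidPr (fpowS _ _ IA)) natrB // subset_leq_card // fpowS.
  by rewrite (big_setID (fpow n I)) /= (setIidPr (fpowS _ _ IA)).
have [rF rF_le sF] := split_sum F (subsetIl _ _).
have [rG rG_le sG] := split_sum G (subsetIr _ _).
rewrite /avg sF sG; set s := \sum_(v in _) _.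
have s_le : `|s| <= #|fpow n I|%:R by exact: sum_norm.
set a : R := #|fpow n F|%:R in rF_le *; set b : R := #|fpow n G|%:R in rG_le *.
set c : R := #|fpow n I|%:R in rF_le rG_le s_le.
have a0 : 0 < a by rewrite ltr0n card_gt0 fpow_neq0.
have ab : a <= b by rewrite ler_nat !card_fpow leq_exp2r.
have b0 : 0 < b by apply: lt_le_trans ab.
have iab : b^-1 <= a^-1 by rewrite lef_pV2.
apply: (@le_trans _ _ (2 * (1 - c / b))).
  have h1 : `|s * (a^-1 - b^-1)| <= c * (a^-1 - b^-1).
    by rewrite normrM [X in _ * X]ger0_norm ?subr_ge0 // ler_wpM2r ?subr_ge0.
  have h2 : `|rF / a| <= 1 - c / a.
    by rewrite normrM normfV (gtr0_norm a0) ler_pdivrMr // mulrBl divfK ?mul1r ?gt_eqF.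
  have h3 : `|rG / b| <= 1 - c / b.
    by rewrite normrM normfV (gtr0_norm b0) ler_pdivrMr // mulrBl divfK ?mul1r ?gt_eqF.
  have -> : (s + rF) / a - (s + rG) / b = s * (a^-1 - b^-1) + rF / a - rG / b by ring.
  apply: le_trans (ler_normB _ _) _.
  apply: le_trans (lerD (le_trans (ler_normD _ _) (lerD h1 h2)) h3) _.
  by rewrite le_eqVlt; apply/orP; left; apply/eqP; ring.
have g0 : 0 < #|G|%:R :> R by rewrite ltr0n card_gt0.
have cI : #|I|%:R = #|G|%:R - #|G :\: F|%:R :> R.
  by rewrite /I setIC -(cardsID F G) natrD addrK.
have -> : c / b = (1 - #|G :\: F|%:R / #|G|%:R) ^+ n.
  by rewrite /c /b !card_fpow !natrX -expr_div_n cI mulrBl divff ?gt_eqF.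
rewrite -mulrA ler_wpM2l //.
set x : R := _ / _; have := bernoulli (1 - x) n; rewrite subKr; apply.
rewrite subr_ge0 gerBl divr_ge0 // ler_pdivrMr // mul1r ler_nat.
by rewrite subset_leq_card // subsetDl.
Qed.

End Contraction.

(** * Orbits and set partitions *)

Section Partitions.
Context {n k : nat}.
Implicit Types (u v w : state n k) (s t : {perm 'I_k}).

Lemma actM s t u : Defs.act (s * t)%g u = Defs.act t (Defs.act s u).
Proof. by apply/ffunP => i; rewrite !ffunE permM. Qed.

(** The permutations sending [u] to a given point of its orbit form a coset of [stab u]. *)
Lemma card_orbitB_stab u : (#|orbitB u| * #|stab u| = #|{perm 'I_k}|)%N.
Proof.
rewrite -sum_nat_const -[RHS]sum1_card.
rewrite (partition_big (fun s => Defs.act s u) (mem (orbitB u))) /= => [|s _];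
  last exact: imset_f.
apply: eq_bigr => w /imsetP[s0 _ ->].
rewrite [RHS](reindex_inj (mulIg s0)) -sum1_card; apply: eq_bigl => s /=.
rewrite inE actM; apply/eqP/eqP => [->//|/ffunP e].
by apply/ffunP => i; have := e i; rewrite !ffunE => /perm_inj.
Qed.

Definition ker_part u := preim_partition u [set: 'I_n].

Lemma ker_partP u v :
  reflect (forall i j, (u i == u j) = (v i == v j)) (ker_part u == ker_part v).
Proof.
apply: (iffP eqP) => [e i j|e]; last first.
  apply: eq_imset => i; apply/setP => j; rewrite !inE; exact: e.
have eqi w : {in [set: 'I_n] & &, equivalence_rel [rel x y | w x == w y]}.
  by split=> //= /eqP->.
have := pblock_equivalence_partition (eqi u) (in_setT i) (in_setT j).
have := pblock_equivalence_partition (eqi v) (in_setT i) (in_setT j).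
by rewrite -/(preim_partition v _) -/(preim_partition u _) -/(ker_part u) e => -> /= ->.
Qed.

Lemma orbitB_ker_part u v : (v \in orbitB u) = (ker_part u == ker_part v).
Proof.
apply/imsetP/ker_partP => [[s _ ->] i j|e].
  by rewrite !ffunE (inj_eq perm_inj).
suff ext m : exists s : {perm 'I_k}, forall i : 'I_n, (i < m)%N -> s (u i) = v i.
  by have [s sP] := ext n; exists s => //; apply/ffunP => i; rewrite ffunE sP.
elim: m => [|m [s IH]]; first by exists 1%g.
have [mn|nm] := ltnP m n; last first.
  by exists s => i _; apply: IH; apply: leq_trans nm.
(* An earlier position whose value meets this transposition agrees with [im] in both [u] and [v],
   and then the transposition is trivial. *)
pose im := Ordinal mn; exists (s * tperm (s (u im)) (v im))%g => i.
rewrite ltnS permM leq_eqVlt => /orP[/eqP eim|im_lt].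
  have -> : i = im by apply: val_inj.
  by rewrite tpermL.
have si := IH i im_lt; rewrite si.
case: tpermP => // [vi|vi].
  rewrite vi; have : u i == u im by rewrite -(inj_eq (@perm_inj _ s)) si vi.
  by rewrite e => /eqP <-; rewrite vi.
have : u i == u im by rewrite e vi.
by move=> /eqP <-; rewrite si.
Qed.

Lemma ker_part_onto (le_nk : (n <= k)%N) (P : {set {set 'I_n}}) :
  partition P [set: 'I_n] -> exists u, ker_part u = P.
Proof.
move=> /and3P[/eqP cP tP P0].
have covT i : i \in cover P by rewrite cP.
(* Each block is labelled by one of its elements; the default is never reached, as [i] lies in its
   own block. *)
pose u : state n k := [ffun i => widen_ord le_nk (odflt i [pick j in pblock P i])].
have uP i : exists2 j, j \in pblock P i & u i = widen_ord le_nk j.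
  rewrite ffunE; case: pickP => [j jP|/(_ i)] /=; first by exists j.
  by rewrite mem_pblock covT.
have partP : partition P [set: 'I_n] by apply/and3P; split=> //; apply/eqP.
exists u; rewrite -[RHS](preim_partition_pblock partP).
apply: eq_imset => i; apply/setP => j; rewrite !inE /=.
apply/eqP/eqP => [|eP]; last first.
  rewrite !ffunE; congr widen_ord; rewrite eP; case: pickP => // /(_ j).
  by rewrite mem_pblock covT.
have [i' i'P ->] := uP i; have [j' j'P ->] := uP j.
move=> /(congr1 val) /= /val_inj e; rewrite -(same_pblock tP i'P) e.
exact: same_pblock.
Qed.

End Partitions.

(** * The chain *)

Section Chain.
Context {R : realType} {n k : nat}.
Hypotheses (n_gt0 : (0 < n)%N) (le_nk : (n <= k)%N).
Implicit Types (u v w : state n k) (s : {perm 'I_k}) (t : nat) (phi : state n k -> R).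

Let k_gt0 : (0 < k)%N. Proof. exact: leq_trans le_nk. Qed.

Lemma stabE u : stab u = pfix (im n u).
Proof.
apply/setP => s; rewrite !inE; apply/eqP/im_subP => [/ffunP e i|e].
  by apply/FxP; have := e i; rewrite ffunE.
by apply/ffunP => i; rewrite ffunE; apply/FxP.
Qed.

Lemma mem_stab s v : (s \in stab v) = (v \in Defs.fixset n s).
Proof. by rewrite !inE. Qed.

Lemma fixsetE s : Defs.fixset n s = fpow n (Fx s).
Proof. by apply/setP => v; rewrite -mem_stab stabE !inE. Qed.

(** Exchanging the sums over [v] and [s] separates the two halves of a step. *)
Lemma sum_Kb u (phi : state n k -> R) :
  \sum_v Kb R u v * phi v = gA (fun F => avg (fpow n F) phi) (im n u).
Proof.
rewrite /gA -stabE /avg mulr_suml.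
under eq_bigr do rewrite /Kb mulr_suml.
rewrite (exchange_big_dep (mem (stab u))) /=; last first.
  by move=> v s _; rewrite inE => /andP[].
apply: eq_bigr => s su; rewrite -fixsetE mulrAC -mulrA -invfM mulr_suml.
apply: eq_big => [v|v _]; first by rewrite inE su mem_stab.
exact: mulrC.
Qed.

Definition Et t (phi : state n k -> R) u : R := \sum_v Kpow R t u v * phi v.

Lemma EtS t phi u :
  Et t.+1 phi u = Et t (fun v => gA (fun F => avg (fpow n F) phi) (im n v)) u.
Proof.
rewrite /Et /=; under eq_bigr do rewrite mulr_suml.
rewrite exchange_big /=; apply: eq_bigr => w _.
by rewrite -sum_Kb mulr_sumr; apply: eq_bigr => v _; rewrite mulrA.
Qed.

Lemma Et0 phi u : Et 0 phi u = phi u.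
Proof.
rewrite /Et (bigD1 u) //= eqxx mul1r big1 ?addr0 // => v vu.
by rewrite eq_sym (negbTE vu) mul0r.
Qed.

Local Notation rho := (1 - (2 * k%:R)^-1 : R).

Lemma rho_ge0 : 0 <= rho.
Proof.
rewrite subr_ge0 invf_le1 ?mulr_gt0 ?ltr0n //.
by rewrite -natrM ler1n muln_gt0.
Qed.

Lemma rho_lt1 : rho < 1.
Proof. by rewrite ltrBlDr ltrDl invr_gt0 mulr_gt0 ?ltr0n. Qed.

(** Functions of the form [gA h (im n u)] keep this form: a step replaces [h] by the function in
    [lip_step]. *)
Lemma Et_gA t L h : 0 <= L -> lip L h ->
  exists2 h', lip (L * rho ^+ t) h' &
  forall u, Et t (fun v => gA h (im n v)) u = gA h' (im n u).
Proof.
elim: t h L => [|t IH] h L L0 hL.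
  by exists h => [|u]; rewrite ?expr0 ?mulr1 // Et0.
have hL' := @lip_step _ _ _ n_gt0 le_nk L h L0 hL.
have [|h' lip_h' Eh'] := IH _ _ _ hL'; first by rewrite mulr_ge0 // rho_ge0.
by exists h' => [|u]; [rewrite exprS mulrA|rewrite EtS Eh'].
Qed.

(** One step makes [phi] Lipschitz, the other [t] gain [rho ^+ t], and [gA_osc] gains two powers:
    the exponent exceeds the time by one. *)
Lemma Et_osc t (phi : state n k -> R) u v : (forall w, `|phi w| <= 1) ->
  `|Et t.+1 phi u - Et t.+1 phi v| <= 2 * (n%:R * rho ^+ t.+2).
Proof.
move=> phi1; rewrite !EtS.
have L0 : 0 <= 2 * n%:R :> R by rewrite mulr_ge0.
have [h' lip_h' E] := Et_gA t _ _ L0 (@lip_avg _ _ _ n_gt0 phi phi1).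
rewrite !E; apply: le_trans (@gA_osc _ _ _ n_gt0 le_nk _ _ _ _ _ lip_h' _ _) _.
- by rewrite mulr_ge0 // exprn_ge0 // rho_ge0.
- exact: im_neq0.
- exact: im_neq0.
- by rewrite -mulrA -exprD addn2 mulrA.
Qed.

Lemma sum_Kb1 u : \sum_v Kb R u v = 1.
Proof.
transitivity (\sum_v Kb R u v * 1); first by apply: eq_bigr => v _; rewrite mulr1.
rewrite sum_Kb /gA (@eq_avg _ _ _ _ (fun=> 1)) ?avg_cst ?pfix_neq0 // => s.
rewrite -stabE mem_stab fixsetE => us; rewrite avg_cst //.
by apply/set0Pn; exists u.
Qed.

(** Orbits correspond to set partitions through [ker_part], and each orbit contributes 1. *)
Lemma Bell_sum : \sum_(u : state n k) (#|orbitB u|%:R)^-1 = (Bell n)%:R :> R.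
Proof.
rewrite (partition_big (@ker_part n k) (mem [set P | partition P [set: 'I_n]])) /=; last first.
  by move=> u _; rewrite inE; exact: preim_partitionP.
rewrite /Bell -[RHS]mulr1 -sum_cst; apply: eq_bigr => P; rewrite inE.
move=> /(ker_part_onto le_nk)[u0 <-].
have oE u : (ker_part u == ker_part u0) = (u \in orbitB u0).
  by rewrite eq_sym orbitB_ker_part.
rewrite (eq_bigl _ _ oE) (eq_bigr (fun=> #|orbitB u0|%:R^-1)) => [|u].
  rewrite sum_cst mulfV // card_neq0 //; apply/set0Pn; exists u0.
  by rewrite orbitB_ker_part.
rewrite -oE => /eqP eu; congr (_%:R^-1); apply: eq_card => w.
by rewrite !orbitB_ker_part eu.
Qed.

Lemma orbitB_gt0 u : 0 < #|orbitB u|%:R :> R.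
Proof. by rewrite ltr0n; apply/card_gt0P; exists u; rewrite orbitB_ker_part. Qed.

Lemma Bell_gt0 : 0 < (Bell n)%:R :> R.
Proof.
rewrite -Bell_sum; pose u : state n k := [ffun=> Ordinal k_gt0].
rewrite (bigD1 u) //= ltr_pwDl ?invr_gt0 ?orbitB_gt0 //.
by apply: sumr_ge0 => v _; rewrite invr_ge0.
Qed.

Lemma sum_piB : \sum_(u : state n k) piB R u = 1.
Proof.
rewrite /piB; under eq_bigr do rewrite invfM.
by rewrite -mulr_sumr Bell_sum mulVf // lt0r_neq0 // Bell_gt0.
Qed.

Lemma piB_ge0 u : 0 <= piB R u.
Proof. by rewrite /piB invr_ge0 mulr_ge0. Qed.

(** By orbit-stabilizer, [#|orbitB u| * #|stab u|] does not depend on [u], which leaves a symmetric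
    sum. *)
Lemma piB_balance u v : piB R u * Kb R u v = piB R v * Kb R v u.
Proof.
have E w w' : piB R w * Kb R w w' = \sum_(s in stab w :&: stab w')
    ((Bell n)%:R * #|{perm 'I_k}|%:R * #|Defs.fixset n s|%:R)^-1.
  rewrite /Kb mulr_sumr; apply: eq_bigr => s _.
  by rewrite /piB -(card_orbitB_stab w) natrM -invfM; congr (_^-1); ring.
by rewrite !E setIC.
Qed.

Lemma sum_piB_Et t (phi : state n k -> R) :
  \sum_u piB R u * Et t phi u = \sum_u piB R u * phi u.
Proof.
elim: t phi => [|t IH] phi; first by apply: eq_bigr => u _; rewrite Et0.
under eq_bigr do rewrite EtS; rewrite IH.
under eq_bigr do rewrite -sum_Kb mulr_sumr.
rewrite exchange_big /=; apply: eq_bigr => v _.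
under eq_bigr do rewrite mulrA piB_balance mulrAC.
by rewrite -mulr_sumr sum_Kb1 mulr1.
Qed.

(** The sign of the difference is the optimal test function [phi]; by stationarity its mean under
    [piB] is that of [Et t phi]. Time 0 uses an [M] that varies with [v]. *)
Lemma tv_piB_le t u (M : state n k -> R) :
  (forall phi, (forall v, `|phi v| <= 1) ->
     forall v, `|Et t phi u - Et t phi v| <= 2 * M v) ->
  tv (Kpow R t u) (@piB R n k) <= \sum_v piB R v * M v.
Proof.
move=> osc; pose phi y : R := Num.sg (Kpow R t u y - piB R y).
have phi1 v : `|phi v| <= 1 by rewrite normr_sg; case: (_ != _).
have -> : tv (Kpow R t u) (@piB R n k) =
    2^-1 * \sum_v piB R v * (Et t phi u - Et t phi v).
  congr (_ * _); under [RHS]eq_bigr do rewrite mulrBr.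
  rewrite sumrB sum_piB_Et -mulr_suml sum_piB mul1r /Et -sumrB.
  by apply: eq_bigr => y _; rewrite -mulrBl mulrC -normrEsg.
rewrite mulr_sumr; apply: ler_sum => v _.
rewrite mulrCA; apply: ler_wpM2l; first exact: piB_ge0.
rewrite mulrC ler_pdivrMr // mulrC.
by apply: le_trans (ler_norm _) _; exact: osc.
Qed.

(** The term [piB R u] matters for the mixing time when [n = 1] and the rounded time is 0. *)
Lemma tv0_le u : tv (Kpow R 0 u) (@piB R n k) <= 1 - piB R u.
Proof.
apply: le_trans (@tv_piB_le 0 u (fun v => (v != u)%:R) _) _.
  move=> phi phi1 v; rewrite !Et0; have [->|_] := eqVneq v u.
    by rewrite subrr normr0 mulr0.
  apply: le_trans (ler_normB _ _) _; apply: le_trans (lerD (phi1 u) (phi1 v)) _.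
  by rewrite mulr1n; lra.
have := sum_piB; rewrite (bigD1 u) //= => /(canRL (addKr _)) sum_off.
rewrite [leRHS]addrC -sum_off (bigD1 u) //= eqxx mulr0n mulr0 add0r.
by apply: ler_sum => v ->; rewrite mulr1n mulr1.
Qed.

Lemma tvS_le t u : tv (Kpow R t.+1 u) (@piB R n k) <= n%:R * rho ^+ t.+2.
Proof.
apply: le_trans (@tv_piB_le t.+1 u (fun=> n%:R * rho ^+ t.+2) _) _.
  by move=> phi phi1 v; exact: Et_osc.
by rewrite -mulr_suml sum_piB mul1r.
Qed.

End Chain.

(** * From the distance bounds to the mixing time *)

Lemma piB1 (R : realType) k (u : state 1 k) : (0 < k)%N -> piB R u = k%:R^-1.
Proof.
move=> k0; have orb (v : state 1 k) : #|orbitB v| = k.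
  have -> : orbitB v = [set: state 1 k].
    apply/setP => w; rewrite orbitB_ker_part inE; apply/ker_partP => i j.
    by rewrite !ord1 !eqxx.
  by rewrite cardsT card_ffun !card_ord expn1.
have := @sum_piB R 1 k (leqnn 1) k0.
rewrite (eq_bigr (fun=> piB R u)) => [|v _]; last by rewrite /piB !orb.
rewrite sumr_const card_ffun !card_ord expn1 -[LHS]mulr_natl => kpi.
by apply: (mulfI (x := k%:R)); rewrite ?kpi ?mulfV // pnatr_eq0 -lt0n.
Qed.

(* Imported only now because it rebinds [set0], [setT], etc. to classical sets. *)
From mathcomp Require Import all_classical all_analysis.
Import Order.TTheory GRing.Theory Num.Theory.

Lemma rho_pow_le (R : realType) (n k m : nat) (eps : R) : (0 < n)%N -> (n <= k)%N ->
  0 < eps -> 2 * k%:R * ln (n%:R / eps) <= m%:R ->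
  n%:R * (1 - (2 * k%:R)^-1) ^+ m <= eps.
Proof.
move=> n0 nk eps0 le_m; have k0 := leq_trans n0 nk.
have k2 : 0 < 2 * k%:R :> R by rewrite mulr_gt0 ?ltr0n.
have nR : 0 < n%:R :> R by rewrite ltr0n.
have ne0 : 0 < n%:R / eps by rewrite divr_gt0.
have rho0 := @rho_ge0 R _ _ n0 nk.
apply: (@le_trans _ _ (n%:R * expR (- ln (n%:R / eps)))).
  rewrite ler_pM2l //; apply: (@le_trans _ _ (expR (- (2 * k%:R)^-1) ^+ m)).
    by rewrite lerXn2r ?nnegrE ?expR_ge0 // expR_ge1Dx.
  rewrite -expRM_natl ler_expR mulrN lerN2 ler_pdivlMr // mulrC //.
by rewrite expRN lnK ?posrE // invfM invrK mulrA divff ?mul1r // lt0r_neq0.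
Qed.

Theorem theorem1p1 (R : realType) (n k : nat) (hn : (1 <= n)%N) (hk : (n <= k)%N) :
  (forall (u : state n k) (t : nat),
     tv (Kpow R t u) (@piB R n k) <= n%:R * (1 - (2 * k%:R)^-1) ^+ t)
  /\
  (forall eps : R, 0 < eps -> eps < 1 ->
     (* t_mix(eps) <= 2k log(n/eps), i.e. the least t with
        max_u TV(K^t_u, pi) <= eps is at most 2k log(n/eps) *)
     exists t : nat,
       t%:R <= 2 * k%:R * ln (n%:R / eps) /\
       forall u : state n k, tv (Kpow R t u) (@piB R n k) <= eps).
Proof.
have k0 : (0 < k)%N by exact: leq_trans hk.
have rho0 := @rho_ge0 R _ _ hn hk; have rho1 := ltW (@rho_lt1 R _ _ hn hk).
split=> [u [|t]|eps eps0 eps1].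
- rewrite expr0 mulr1; apply: le_trans (tv0_le hn hk u) _.
  apply: (@le_trans _ _ 1); first by rewrite gerBl piB_ge0.
  by rewrite ler1n.
- apply: le_trans (tvS_le hn hk t u) _; rewrite ler_wpM2l //.
  by rewrite [leLHS]exprS ler_piMl // exprn_ge0.
set x := 2 * k%:R * ln (n%:R / eps).
have x0 : 0 <= x.
  rewrite mulr_ge0 // ln_ge0 // ler_pdivlMr // mul1r.
  by apply: le_trans (ltW eps1) _; rewrite ler1n.
have /andP[tx xt] := Num.Theory.truncn_itv x0.
(* An integer time at most [x] forces rounding down. [rho_pow_le] applies to the power
   [truncn x + 1 > x], which is the exponent in [tvS_le] at a positive time [truncn x]. *)
exists (Num.truncn x); split=> // u.
have bound := rho_pow_le _ _ _ _ _ hn hk eps0 (ltW xt).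
case: (Num.truncn x) bound => [|t] bound; last exact: le_trans (tvS_le hn hk t u) bound.
(* For [t = 0] the bound forces [n = 1], as [n (1 - 1/(2k)) >= n/2]. *)
rewrite expr1 in bound.
have n1 : n = 1%N.
  apply/eqP; rewrite eqn_leq hn andbT leqNgt; apply/negP => n2.
  have := le_lt_trans bound eps1; apply/negP; rewrite -leNgt.
  apply: (@le_trans _ _ (2 * 2^-1)); first by rewrite divff.
  apply: ler_pM; rewrite ?ler_nat // invfM lerBrDr.
  have : k%:R^-1 <= 1 :> R by rewrite invf_le1 ?ltr0n // ler1n.
  lra.
(* Here [piB R u = 1/k], and [1 - 1/k <= 1 - 1/(2k)]. *)
subst n; apply: le_trans (tv0_le hn hk u) _; apply: le_trans bound.
rewrite mul1r lerD2l lerN2 piB1 // invfM ler_piMl ?invr_ge0 //.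
by rewrite invf_le1 // ler1n.
Qed.
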